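(* Let $X$ be a real Banach space with norm $\|\cdot\|$, and let $\Phi: X\to\mathbb{R}$ be a locally Lipschitz functional. For $z_0,z_1\in X$ define $$\Gamma:=\{c\in C^0([0,1];X): c(0)=z_0,\ c(1)=z_1\},\qquad \gamma:=\inf_{c\in\Gamma}\max_{0\le t\le 1}\Phi(c(t)),$$ and set $\Phi_\gamma:=\{x\in X:\Phi(x)\ge\gamma\}$. Let $F\subset X$ be a closed, norm-bounded subset such that $F\cap\Phi_\gamma$ separates $z_0$ and $z_1$. If $\Phi$ satisfies the $(CPS)_{F,\gamma}$ condition, then there exists a critical point $\bar x\in F$ of $\Phi$ with critical value $\gamma$: $\Phi(\bar x)=\gamma$ and $0\in\partial\Phi(\bar x)$.
   Context: $C^0([0,1];X)$ is the space of continuous maps from $[0,1]$ to $X$, and $d(x,F):=\inf_{y\in F}\|x-y\|$. Clarke generalized gradient: for a locally Lipschitz $\Phi:X\to\mathbb{R}$, the generalized directional derivative is $\Phi^0(x,v):=\limsup_{w\to x,\ t\downarrow 0}\frac{\Phi(w+tv)-\Phi(w)}{t}$, and $\partial\Phi(x):=\{x^*\in X^*:\langle x^*,v\rangle\le\Phi^0(x,v)\ \forall v\in X\}$. $(CPS)_{F,c}$ condition (for a closed $F\subset X$ and $c\in\mathbb{R}$): every sequence $\{x_n\}\subset X$ with (1) $d(x_n,F)\to0$, (2) $\Phi(x_n)\to c$, (3) $(1+\|x_n\|)\min_{y^*\in\partial\Phi(x_n)}\|y^*\|\to0$ has a (norm-)convergent subsequence. Separation: a closed set $S\subset X$ separates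 $z_0$ and $z_1$ if $X\setminus S=\Omega_0\cup\Omega_1$ with $\Omega_0,\Omega_1$ open, $\Omega_0\cap\Omega_1=\emptyset$, $z_0\in\Omega_0$ and $z_1\in\Omega_1$. *)

(* Defs.v *)
From HB Require Import structures.
From mathcomp Require Import all_boot all_order all_algebra.
From mathcomp Require Import all_classical all_reals all_analysis.

Set Implicit Arguments.
Unset Strict Implicit.
Unset Printing Implicit Defensive.

Import Order.TTheory GRing.Theory Num.Theory.
Import numFieldNormedType.Exports.

Local Open Scope classical_set_scope.
Local Open Scope ring_scope.

Section defs.
Variables (R : realType) (X : normedModType R).
Implicit Types (Phi : X -> R) (F S : set X) (x v : X).

(* The library's [locally [lipschitz f x | x in setT]] asks for a Lipschitz
   bound around each pair (x, y) of points of X * X, not around each point. *)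
Definition locally_lipschitz Phi : Prop :=
  forall x, exists2 U : set X, nbhs x U & [lipschitz (Phi y : R^o) | y in U].

(* The limsup is taken over all w near x, including w = x, and t > 0 near 0;
   it is finite when Phi is Lipschitz near x. *)
Definition clarke_dd Phi x v : \bar R :=
  limf_esup (fun p : X * R => ((Phi (p.1 + p.2 *: v) - Phi p.1) / p.2)%:E)
    (filter_prod (nbhs x) (at_right 0)).

(* The elements of the topological dual of X are the linear forms
   X -> R^o that are continuous. *)
Definition clarke_subdiff Phi x : set {linear X -> R^o} :=
  [set f : {linear X -> R^o} |
    continuous f /\ forall v, ((f v : R)%:E <= clarke_dd Phi x v)%E].

Definition dual_norm (f : {linear X -> R^o}) : R :=
  sup [set `|f v| | v in [set v | `|v| <= 1]].

(* For Phi locally Lipschitz, clarke_subdiff Phi x is nonempty and weak-*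
   compact, so this infimum is the minimum of the norm. *)
Definition min_subdiff_norm Phi x : R :=
  inf [set dual_norm f | f in clarke_subdiff Phi x].

(* Extended-real valued, so that the distance to the empty set is +oo. *)
Definition dist_to x F : \bar R := ereal_inf [set `|x - y|%:E | y in F].

Definition CPS Phi F (c : R) : Prop :=
  forall x_ : nat -> X,
    dist_to (x_ n) F @[n --> \oo] --> 0%E ->
    Phi (x_ n) @[n --> \oo] --> c ->
    (1 + `|x_ n|) * min_subdiff_norm Phi (x_ n) @[n --> \oo] --> 0 ->
  exists2 k : nat -> nat, increasing_seq k & cvgn (x_ \o k).

(* Only the restriction of a path to [0, 1] matters. *)
Definition paths (z0 z1 : X) : set (R -> X) :=
  [set c : R -> X | [/\ {within `[0, 1], continuous c}, c 0 = z0 & c 1 = z1]].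

(* The inner supremum is a maximum, by compactness of [0, 1]. *)
Definition minimax Phi (z0 z1 : X) : R :=
  inf [set sup [set Phi (c t) | t in `[0, 1 : R]] | c in paths z0 z1].

Definition superlevel Phi (a : R) : set X := [set x | a <= Phi x].

Definition separates S (z0 z1 : X) : Prop :=
  closed S /\
  exists O0 O1 : set X,
    [/\ open O0, open O1, O0 `&` O1 = set0, ~` S = O0 `|` O1 & O0 z0 /\ O1 z1].

End defs.

(* Main.v *)
Require Import Defs.
From HB Require Import structures.
From mathcomp Require Import all_boot all_order all_algebra.
From mathcomp Require Import all_classical all_reals all_analysis.
From mathcomp Require Import ring lra.

Set Implicit Arguments.
Unset Strict Implicit.
Unset Printing Implicit Defensive.

Import Order.TTheory GRing.Theory Num.Theory.
Import numFieldNormedType.Exports.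

Local Open Scope classical_set_scope.
Local Open Scope ring_scope.

(* The argument is that of Ghoussoub and Preiss. Suppose there is no critical
   point in F at level gamma, and let S be the separating set. By the
   Palais-Smale condition and a Hahn-Banach sandwich argument, at every point
   near S and near the level some direction decreases Phi at a uniform rate.
   Take an almost optimal path and keep only a piece of it that passes from one
   side of S to the other while staying e-close to S. Every path with the same
   ends crosses S, where Phi + psi >= gamma + e^2 for the penalty
   psi = max(0, e^2 - e d(., S)), so Ekeland's principle yields, uniformly near
   this piece, a path whose maximum of Phi + psi cannot be lowered at rate e/2.
   The descent directions along this path, glued over a finite cover of the set
   of nearly maximal parameters, lower it at a faster rate. *)

(** * Hahn-Banach theorem in sublinear form *)

Section hahn_banach.
Context {R : realType} {X : lmodType R}.
Implicit Types p q : X -> R.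

(** Homogeneity is only an inequality for positive factors, which is easy to check on infima;
    applied to the inverse factor it yields equality ([sublinearZ]). *)
Definition sublinear p :=
  (forall u v, p (u + v) <= p u + p v) /\
  (forall a v, 0 < a -> p (a *: v) <= a * p v).

Lemma sublinear0 p : sublinear p -> p 0 = 0.
Proof.
move=> [pD pZ].
have h1 := pD 0 0; have h2 := pZ (2^-1) 0 ltac:(lra).
rewrite addr0 in h1; rewrite scaler0 in h2; lra.
Qed.

Lemma sublinearZ p a v : sublinear p -> 0 <= a -> p (a *: v) = a * p v.
Proof.
move=> sp; rewrite le_eqVlt => /predU1P[<-|a0].
  by rewrite scale0r mul0r sublinear0.
apply/eqP; rewrite eq_le; apply/andP; split; first exact: sp.2.
rewrite -ler_pdivlMl// -{1}(scale1r v) -(mulVf (lt0r_neq0 a0)) -scalerA.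
by apply: sp.2; rewrite invr_gt0.
Qed.

Lemma sublinearN p v : sublinear p -> - p (- v) <= p v.
Proof.
move=> sp; have := sp.1 v (- v); rewrite subrr sublinear0//; lra.
Qed.

(** Chain condition for Zorn. The bound [- q (- v)] keeps the infima finite, and subadditivity
    survives because, of two members of the chain, the smaller one can be used at both vectors. *)
Lemma inf_chain_sublinear q (A : set (X -> R)) : A !=set0 ->
  (forall p, A p -> sublinear p /\ forall v, p v <= q v) ->
  total_on A (fun p p' => forall v, p' v <= p v) ->
  let m v := inf [set p v | p in A] in
  sublinear m /\ forall p v, A p -> m v <= p v.
Proof.
move=> [p0 Ap0] Aq Atot m.
have mlb v : has_lbound [set p v | p in A].
  exists (- q (- v)) => _ [p Ap <-].
  have [sp pq] := Aq p Ap.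
  by apply: le_trans (sublinearN v sp); rewrite lerN2.
have mle p v : A p -> m v <= p v by move=> Ap; apply: ge_inf => //; exists p.
split=> //; split.
- move=> u v; rewrite -lerBlDr; apply: lb_le_inf; first by exists (p0 u), p0.
  move=> _ [p Ap <-]; rewrite lerBlDl -lerBlDr.
  apply: lb_le_inf; first by exists (p0 v), p0.
  move=> _ [p' Ap' <-]; rewrite lerBlDr.
  have [pp'|p'p] := Atot p p' Ap Ap'.
  + have := (Aq _ Ap').1.1 u v; have := mle _ (u + v) Ap'; have := pp' u; lra.
  + have := (Aq _ Ap).1.1 u v; have := mle _ (u + v) Ap; have := p'p v; lra.
- move=> a v a0; rewrite -ler_pdivrMl//; apply: lb_le_inf.
    by exists (p0 v), p0.
  move=> _ [p Ap <-]; rewrite ler_pdivrMl//.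
  by apply: (le_trans (mle _ _ Ap)); apply: (Aq _ Ap).1.2.
Qed.

(* Pushing [p] down along the ray spanned by [x]; if [p] is minimal this
   changes nothing, which forces [p (v + x) = p v + p x]. *)
Lemma lower_sublinear p x : sublinear p ->
  let m v := inf [set p (v + t *: x) - t * p x | t in [set t | 0 <= t]] in
  sublinear m /\ forall v t, 0 <= t -> m v <= p (v + t *: x) - t * p x.
Proof.
move=> sp m.
have mlb v : has_lbound [set p (v + t *: x) - t * p x | t in [set t | 0 <= t]].
  exists (- p (- v)) => _ [t /= t0 <-].
  have := sp.1 (v + t *: x) (- v); rewrite addrAC subrr add0r sublinearZ//; lra.
have mle v t : 0 <= t -> m v <= p (v + t *: x) - t * p x.
  by move=> t0; apply: ge_inf => //; exists t.
have ne v : [set p (v + t *: x) - t * p x | t in [set t | 0 <= t]] !=set0.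
  by exists (p (v + 0 *: x) - 0 * p x), 0 => /=.
split=> //; split.
- move=> u v; rewrite -lerBlDr; apply: lb_le_inf => // _ [s /= s0 <-].
  rewrite lerBlDl -lerBlDr; apply: lb_le_inf => // _ [t /= t0 <-].
  have := mle (u + v) (s + t) (addr_ge0 s0 t0).
  have := sp.1 (u + s *: x) (v + t *: x).
  rewrite addrACA -scalerDl; lra.
- move=> a v a0; rewrite -ler_pdivrMl//; apply: lb_le_inf => // _ [t /= t0 <-].
  rewrite ler_pdivrMl//.
  have := mle (a *: v) (a * t) (mulr_ge0 (ltW a0) t0).
  have := sp.2 a (v + t *: x) a0; rewrite scalerDr scalerA; lra.
Qed.

(** Zorn gives a minimal sublinear function below [q]. By minimality [lower_sublinear] cannot change
    it, so it is additive, hence odd, hence linear. *)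
Theorem hahn_banach_sublinear q : sublinear q ->
  exists f : {linear X -> R^o}, forall v, (f v : R) <= q v.
Proof.
move=> sq.
pose T := {p : X -> R | sublinear p /\ forall v, p v <= q v}.
(* The order is reversed: maximal elements for [leT] are minimal functions. *)
pose leT (s t : T) : bool := `[< forall v, sval t v <= sval s v >].
have [||||[p [sp pq]] pmin] := @Zorn T leT.
- by move=> s; apply/asboolP.
- move=> r s t /asboolP rs /asboolP st; apply/asboolP => v.
  exact: le_trans (st v) (rs v).
- move=> [s Ps] [t Pt] /asboolP/= st /asboolP/= ts.
  have st_eq : s = t by apply/funext => v; apply/eqP; rewrite eq_le st ts.
  by subst t; congr exist; exact: Prop_irrelevance.
- move=> A Atot; have [[s0 As0]|nA] := pselect (A !=set0); last first.
    by exists (exist _ q (conj sq (fun v => lexx (q v)))) => s As; case: nA; exists s.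
  have As0' : [set sval s | s in A] !=set0 by exists (sval s0), s0.
  have [||sm mle] := @inf_chain_sublinear q _ As0'.
  + by move=> _ [s As <-]; exact: (svalP s).
  + move=> _ _ [s As <-] [t At <-].
    by have [/asboolP|/asboolP] := Atot s t As At; [left|right].
  set m := (X in sublinear X) in sm.
  have mq v : m v <= q v.
    by apply: le_trans ((svalP s0).2 v); apply: mle; exists s0.
  exists (exist _ m (conj sm mq)) => s As; apply/asboolP => v /=.
  by apply: mle; exists s.
have pD u x : p (u + x) = p u + p x.
  have [sm mle] := lower_sublinear x sp.
  set m := (X in sublinear X) in sm.
  have mp v : m v <= p v.
    by have := mle v 0 (lexx _); rewrite scale0r mul0r addr0 subr0.
  have mq v : m v <= q v := le_trans (mp v) (pq v).
  have mpE : m = p.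
    have le_pm : leT (exist _ p (conj sp pq)) (exist _ m (conj sm mq)).
      exact/asboolP.
    exact: (congr1 sval (pmin _ le_pm)).
  have : m u <= p (u + 1 *: x) - 1 * p x by apply: mle.
  have := sp.1 u x; rewrite mpE scale1r mul1r; lra.
have pN v : p (- v) = - p v.
  by have := pD v (- v); rewrite subrr sublinear0//; lra.
have plin : GRing.linear_for *%R p.
  move=> a u v; rewrite pD; congr (_ + _).
  have [a0|a0] := leP 0 a; first exact: sublinearZ.
  have Na0 : 0 <= - a by lra.
  by have := sublinearZ u sp Na0; rewrite scaleNr pN mulNr => /oppr_inj.
pose fL := GRing.isLinear.Build R X R^o _ (p : X -> R^o) plin.
pose f : {linear X -> R^o} := HB.pack (p : X -> R^o) fL.
by exists f.
Qed.

End hahn_banach.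

(** * Clarke derivatives and small subgradients *)

Section clarke.
Context {R : realType} {X : normedModType R} (Phi : X -> R).
Implicit Types (x v w : X) (k e : R).

(* A limsup-free stand-in for Phi^0(x, v) <= k, lying between the strict and
   the non-strict inequality. *)
Definition dd_le x v k := exists2 d, 0 < d &
  forall w h, `|w - x| < d -> 0 < h -> h < d -> Phi (w + h *: v) <= Phi w + h * k.

Lemma clarke_dd_ltP x v (r : R) : (clarke_dd Phi x v < r%:E)%E ->
  exists2 k, k < r & dd_le x v k.
Proof.
rewrite /clarke_dd /limf_esup => /ereal_inf_lt[_ [V Vx <-]] supV.
(* The supremum over [V] may be -oo; then any real below [r] serves. *)
have [k [kr supk]] : exists k,
    k < r /\ (ereal_sup [set ((Phi (p.1 + p.2 *: v) - Phi p.1) / p.2)%:E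
                        | p in V] <= k%:E)%E.
  move: supV; case: (ereal_sup _) => [s||]//= sr.
    by exists s; rewrite -lte_fin.
  by exists (r - 1); split; [lra|rewrite leNye].
exists k => //; move: Vx => [[A B]/= [Ax B0] ABV].
have [d1 /= d10 d1A] := (nbhs_ballP _ _).1 Ax.
have [d2 /= d20 d2B] := B0.
exists (Num.min d1 d2); first by rewrite lt_min d10 d20.
move=> w h; rewrite !lt_min => /andP[wd1 _] h0 /andP[_ hd2].
have Vwh : V (w, h).
  apply: ABV; split => /=; first by apply: d1A; rewrite -ball_normE/= distrC.
  by apply: d2B => //=; rewrite sub0r normrN gtr0_norm.
have : (((Phi (w + h *: v) - Phi w) / h)%:E <= k%:E)%E.
  by apply: le_trans supk; apply: ereal_sup_ubound; exists (w, h).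
by rewrite lee_fin ler_pdivrMr// lerBlDl mulrC.
Qed.

Lemma dd_le0 x : dd_le x 0 0.
Proof. by exists 1 => // w h _ _ _; rewrite scaler0 mulr0 !addr0. Qed.

Lemma dd_leD x u v k l : dd_le x u k -> dd_le x v l -> dd_le x (u + v) (k + l).
Proof.
move=> [d1 d10 H1] [d2 d20 H2].
have u0 : 0 < 2 * (`|u| + 1) by have := normr_ge0 u; lra.
(* The increment is made along [u] first, then along [v]. The last bound gives [h *: u] norm below
   [d2 / 2], so the second move starts within [d2] of [x]. *)
exists (Num.min d1 (Num.min (d2 / 2) (d2 / (2 * (`|u| + 1))))).
  by rewrite !lt_min d10 !divr_gt0.
move=> w h; rewrite !lt_min => /and3P[w1 w2 _] h0 /and3P[h1 h2 h3].
have hu : `|h *: u| < d2 / 2.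
  rewrite normrZ gtr0_norm//; move: h3; rewrite ltr_pdivlMr//; lra.
rewrite scalerDr addrA.
have := H1 w h w1 h0 h1.
have : Phi (w + h *: u + h *: v) <= Phi (w + h *: u) + h * l.
  apply: H2 => //; last lra.
  by rewrite addrAC; apply: (le_lt_trans (ler_normD _ _)); lra.
lra.
Qed.

Lemma dd_leZ x v k a : 0 < a -> dd_le x v k -> dd_le x (a *: v) (a * k).
Proof.
move=> a0 [d d0 H]; exists (Num.min d (d / a)); first by rewrite lt_min d0 divr_gt0.
move=> w h; rewrite !lt_min => /andP[wd _] h0 /andP[_ hd].
rewrite scalerA mulrA; apply: H => //; first exact: mulr_gt0.
by rewrite -ltr_pdivlMr.
Qed.

Lemma clarke_subdiffI x (f : {linear X -> R^o}) : continuous f ->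
  (forall v k, dd_le x v k -> (f v : R) <= k) -> clarke_subdiff Phi x f.
Proof.
move=> cf fle; split=> // v; rewrite leNgt; apply/negP => /clarke_dd_ltP[k kf].
by move=> /fle; rewrite leNgt kf.
Qed.

(** Hahn-Banach is applied to the infimal convolution of the directional derivative with [e] times
    the norm, that is, the infimum of [k + e * |v - u|] over [dd_le x u k]. The hypothesis makes it
    finite; a linear form below it is below the derivative (take [u = v]) and below [e] times the
    norm (take [u = 0]). *)
Lemma clarke_subdiff_exists x e : 0 <= e ->
  (forall v k, dd_le x v k -> - (e * `|v|) <= k) ->
  exists2 f : {linear X -> R^o}, clarke_subdiff Phi x f &
    forall v, `|f v| <= e * `|v|.
Proof.
move=> e0 lb.
pose E v := [set p.2 + e * `|v - p.1| | p in [set p : X * R | dd_le x p.1 p.2]].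
have Elb v : lbound (E v) (- (e * `|v|)).
  move=> _ [[u k]/= uk <-]; have := lb _ _ uk.
  have := ler_wpM2l e0 (ler_distD 0 u v).
  have := ler_wpM2l e0 (ler_normB v (v - u)).
  rewrite opprB addrC subrK; lra.
have qle v u k : dd_le x u k -> inf (E v) <= k + e * `|v - u|.
  by move=> uk; apply: ge_inf; [exists (- (e * `|v|))|exists (u, k)].
have Ene v : E v !=set0 by exists (0 + e * `|v - 0|), (0, 0); first exact: dd_le0.
have sq : sublinear (fun v => inf (E v)).
  split.
  - move=> u v; rewrite -lerBlDr; apply: lb_le_inf => // _ [[u1 k1]/= uk1 <-].
    rewrite lerBlDl -lerBlDr; apply: lb_le_inf => // _ [[v1 l1]/= vl1 <-].
    have := qle (u + v) _ _ (dd_leD uk1 vl1).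
    have := ler_wpM2l e0 (ler_normD (u - u1) (v - v1)).
    rewrite addrACA -opprD; lra.
  - move=> a v a0; rewrite -ler_pdivrMl//; apply: lb_le_inf => // _ [[u1 k1]/= uk1 <-].
    rewrite ler_pdivrMl//.
    have := qle (a *: v) _ _ (dd_leZ a0 uk1).
    rewrite -scalerBr normrZ gtr0_norm//; lra.
have [f fq] := hahn_banach_sublinear sq.
have fe v : (f v : R) <= e * `|v|.
  by apply: (le_trans (fq v)); have := qle v _ _ (dd_le0 x); rewrite subr0 add0r.
have fabs v : `|f v| <= e * `|v|.
  rewrite ler_norml fe andbT.
  by have := fe (- v); rewrite linearN normrN /=; lra.
exists f => //; apply: clarke_subdiffI => [|v k vk]; last first.
  by apply: (le_trans (fq v)); have := qle v _ _ vk; rewrite subrr normr0 mulr0 addr0.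
apply: bounded_linear_continuous; apply/linear_boundedP.
near=> r => y; apply: (le_trans (fabs y)).
by apply: ler_wpM2r => //; near: r; exact: nbhs_pinfty_ge.
Unshelve. all: by end_near. Qed.

Lemma dual_norm_ge0 (f : {linear X -> R^o}) : 0 <= dual_norm f.
Proof.
rewrite /dual_norm; set S := [set _ | _ in _].
have S0 : S 0 by exists 0 => /=; rewrite ?linear0 normr0.
have [ubS|nubS] := pselect (has_ubound S); first exact: ub_le_sup.
(* Without an upper bound, [sup] takes its default value 0. *)
by rewrite sup_out// => -[].
Qed.

(** Translates the absence of steep descent at [x] into the quantity that [CPS] controls. *)
Lemma min_subdiff_norm_bounds x e : 0 <= e ->
  (forall v k, dd_le x v k -> - (e * `|v|) <= k) ->
  0 <= min_subdiff_norm Phi x <= e.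
Proof.
move=> e0 lb; have [f fx fe] := clarke_subdiff_exists e0 lb.
have S0 : lbound [set dual_norm f | f in clarke_subdiff Phi x] 0.
  by move=> _ [g _ <-]; exact: dual_norm_ge0.
apply/andP; split; first by apply: lb_le_inf => //; exists (dual_norm f), f.
apply: (@le_trans _ _ (dual_norm f)); first by apply: ge_inf; [exists 0|exists f].
apply: ge_sup; first by exists `|f 0|, 0 => //=; rewrite normr0.
move=> _ [v /= v1 <-]; apply: (le_trans (fe v)).
by rewrite -[leRHS]mulr1; apply: ler_wpM2l.
Qed.

End clarke.

Lemma natSinv_lt (R : realType) (e : R) : 0 < e ->
  exists N, forall n, (N <= n)%N -> n.+1%:R^-1 < e.
Proof. by move=> e0; have [N _ HN] := near_infty_natSinv_lt (PosNum e0); exists N. Qed.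

(** * Ekeland's variational principle *)

Section ekeland.
Context {R : realType} {T : Type} (d : T -> T -> R) (f : T -> R).
Hypothesis d_ge0 : forall x y, 0 <= d x y.
Hypothesis d_xx : forall x, d x x = 0.
Hypothesis d_tri : forall y x z, d x z <= d x y + d y z.

Let tends (u : nat -> T) x :=
  forall e, 0 < e -> exists N, forall n, (N <= n)%N -> d (u n) x <= e.

Hypothesis d_complete : forall u : nat -> T,
  (forall e, 0 < e -> exists N, forall n m, (N <= n <= m)%N -> d (u n) (u m) <= e) ->
  exists x, tends u x.
Hypothesis f_lsc : forall u x r N, tends u x ->
  (forall n, (N <= n)%N -> f (u n) <= r) -> f x <= r.
Hypothesis f_lb : has_lbound (range f).

(** Order the points by [S x y], meaning that going from [x] to [y] lowers [f] by at least
    [lam * d x y]. A sequence that descends almost as far as possible at each step converges to a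
    point below which [f] cannot decrease strictly. *)
Theorem ekeland (x0 : T) (lam : R) : 0 < lam ->
  exists x, f x + lam * d x0 x <= f x0 /\ forall y, f x <= f y + lam * d x y.
Proof.
move=> lam0.
pose S x y := f y + lam * d x y <= f x.
have Sxx x : S x x by rewrite /S d_xx mulr0 addr0.
have Strans x y z : S x y -> S y z -> S x z.
  by rewrite /S => xy yz; have := ler_wpM2l (ltW lam0) (d_tri y x z); lra.
(* The pair carries the index [n], which sets the tolerance 1/(n+1), and the current point. *)
have step (p : nat * T) : exists y, S p.2 y /\
    forall z, S p.2 z -> f y <= f z + p.1.+1%:R^-1.
  have infS : has_inf (f @` S p.2).
    split; first by exists (f p.2), p.2.
    by have [b fb] := f_lb; exists b => _ [z _ <-]; apply: fb; exists z.
  have e0 : 0 < p.1.+1%:R^-1 :> R by rewrite invr_gt0.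
  have [_ [y Sy <-] ylt] := inf_adherent e0 infS.
  exists y; split => // z Sz; apply: (le_trans (ltW ylt)); rewrite lerD2r.
  by apply: ge_inf; [exact: infS.2|exists z].
have [g gP] := choice step.
pose u := fix u n := if n is n'.+1 then g (n', u n') else x0.
have uS n m : (n <= m)%N -> S (u n) (u m).
  elim: m => [|m IH]; first by rewrite leqn0 => /eqP->.
  rewrite leq_eqVlt => /predU1P[->//|]; rewrite ltnS => /IH Snm.
  exact: Strans Snm (gP (m, u m)).1.
have infu : has_inf (range (f \o u)).
  split; first by exists (f (u 0)), 0%N.
  by have [b fb] := f_lb; exists b => _ [n _ <-]; apply: fb; exists (u n).
have [x ux] : exists x, tends u x.
  apply: d_complete => e e0.
  (* Beyond [N] the values of [f] can drop by less than [lam * e] in total, and each drop dominates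
     [lam] times the distance. *)
  have [_ [N _ <-] /= uN] := inf_adherent (mulr_gt0 lam0 e0) infu.
  exists N => n m /andP[Nn nm].
  have um : inf (range (f \o u)) <= f (u m) by apply: ge_inf; [exact: infu.2|exists m].
  have := uS _ _ Nn; have := uS _ _ nm; rewrite /S => h1 h2.
  have := mulr_ge0 (ltW lam0) (d_ge0 (u N) (u n)) => h3.
  by rewrite -(ler_pM2l lam0); lra.
have Sux n : S (u n) x.
  apply/ler_addgt0Pr => e e0; rewrite -lerBrDr.
  have e1 : 0 < e / lam by rewrite divr_gt0.
  have [N uN] := ux _ e1.
  apply: (f_lsc (N := maxn n N) ux) => m; rewrite geq_max => /andP[nm Nm].
  have := uS _ _ nm; rewrite /S => h1.
  have := ler_wpM2l (ltW lam0) (d_tri (u m) (u n) x).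
  have := ler_wpM2l (ltW lam0) (uN m Nm).
  have -> : lam * (e / lam) = e by rewrite mulrC divfK ?gt_eqF.
  lra.
exists x; split; first exact: (Sux 0%N).
move=> y; rewrite leNgt; apply/negP => fy.
have Sxy : S x y by rewrite /S ltW.
(* Since [y] lies below every [u n], it competed at every step: [f (u N.+1)] exceeds [f y] by at
   most 1/(N+1), and [f x] is no larger than [f (u N.+1)]. *)
suff : f x <= f y by have := mulr_ge0 (ltW lam0) (d_ge0 x y); lra.
apply/ler_addgt0Pr => e e0; have [N /(_ _ (leqnn N)) Ne] := natSinv_lt e0.
have uNy : f (u N.+1) <= f y + N.+1%:R^-1.
  exact: (gP (N, u N)).2 y (Strans _ _ _ (Sux N) Sxy).
have := mulr_ge0 (ltW lam0) (d_ge0 (u N.+1) x).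
have : f x + lam * d (u N.+1) x <= f (u N.+1) by exact: Sux.
by move: (N.+1%:R^-1) Ne uNy => a Ne uNy; lra.
Qed.

End ekeland.

(** * Gluing descent directions along a curve *)

Section deformation.
Context {R : realType} {X : normedModType R} (Phi : X -> R).
Variables (p : R -> X) (kappa : R) (O : set R).
Hypothesis p_cont : continuous p.

(** The invariant of the gluing. [S t] is the total weight of the directions already combined into
    [u t], and [kappa] the rate of descent per unit of weight. The radius in [descent_rate] is
    uniform in [t], so a single step size will serve the whole curve. *)
Record descent_field (u : R -> X) (S : R -> R) : Prop := {
  descent_cont : continuous u;
  strength_cont : continuous S;
  strength_bound : forall t, 0 <= S t <= 1;
  strength_out : forall t, ~ O t -> S t = 0;
  descent_norm : forall t, `|u t| <= S t;
  descent_rate : exists2 dl, 0 < dl & forall t w h,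
    `|w - p t| < dl -> 0 < h -> h < dl ->
    Phi (w + h *: u t) <= Phi w - h * (kappa * S t) }.

Lemma descent_field0 : descent_field (fun=> 0) (fun=> 0).
Proof.
split=> //.
- by move=> t; exact: cvg_cst.
- by move=> t; exact: cvg_cst.
- by move=> t; rewrite lexx ler01.
- by move=> t; rewrite normr0.
- by exists 1 => // t w h _ _ _; rewrite scaler0 addr0 !mulr0 subr0.
Qed.

(* The strength is raised by [min(bump, 1 - S)]: it stays at most 1, never
   decreases, and becomes 1 where the bump is 1. *)
Lemma descent_field_extend (t0 : R) (v : X) : open O -> O t0 ->
  `|v| <= 1 -> dd_le Phi (p t0) v (- kappa) ->
  exists2 r, 0 < r & forall u S, descent_field u S ->
    exists u' S', [/\ descent_field u' S', (forall t, S t <= S' t) &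
                      forall t, `|t - t0| < r -> S' t = 1].
Proof.
move=> oO Ot0 v1 [dv dv0 Hv].
have dv2 : 0 < dv / 2 by rewrite divr_gt0.
have : nbhs t0 (O `&` [set s | `|p t0 - p s| < dv / 2]).
  apply: filterI; first exact: open_nbhs_nbhs.
  have /cvgrPdist_lt : {for t0, continuous p} by exact: p_cont.
  by apply.
move=> /nbhs_ballP[r2 /= r20 Hr2].
pose r := r2 / 2; have r0 : 0 < r by rewrite divr_gt0.
(* Equal to 1 within [r] of [t0] and to 0 from distance [2 * r = r2] on. *)
pose bump t := Num.max 0 (Num.min 1 (2 - `|t - t0| / r)).
have bump1 t : `|t - t0| < r -> bump t = 1.
  move=> tr; have : `|t - t0| / r < 1 by rewrite ltr_pdivrMr// mul1r.
  by move=> h; rewrite /bump min_l ?max_r//; lra.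
have bump_in t : 0 < bump t -> `|t - t0| < r2.
  rewrite /bump lt_max ltxx/= lt_min => /andP[_].
  by rewrite subr_gt0 ltr_pdivrMr// /r mulrC divfK.
have bump_ge0 t : 0 <= bump t by rewrite /bump le_max lexx.
have bump_cont : continuous bump.
  have -> : bump = (fun=> 0) \max ((fun=> 1) \min (fun t => 2 - `|t - t0| / r)).
    by [].
  move=> t; apply: continuous_max; first exact: cvg_cst.
  apply: continuous_min; first exact: cvg_cst.
  apply: cvgB; first exact: cvg_cst.
  apply: cvgMl; apply: cvg_norm; apply: cvgB; [exact: cvg_id|exact: cvg_cst].
exists r => // u S [uc Sc S01 Sout uS [dl dl0 Hu]].
pose th t := Num.min (bump t) (1 - S t).
have th_ge0 t : 0 <= th t by rewrite /th le_min bump_ge0; have := S01 t; lra.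
have th_le t : th t <= 1 - S t by rewrite /th ge_min lexx orbT.
have th_in t : th t != 0 -> `|t - t0| < r2.
  move=> th0; apply: bump_in.
  have : 0 < th t by rewrite lt_neqAle eq_sym th0 th_ge0.
  by rewrite /th lt_min => /andP[].
have th_cont : continuous th.
  have -> : th = bump \min (fun t => 1 - S t) by [].
  move=> t; apply: continuous_min; first exact: bump_cont.
  by apply: cvgB; [exact: cvg_cst|exact: Sc].
exists (fun t => u t + th t *: v), (fun t => S t + th t); split; last 2 first.
- by move=> t; rewrite lerDl.
- by move=> t tr; rewrite /th bump1// min_r; [lra|have := S01 t; lra].
split.
- by move=> t; apply: cvgD; [exact: uc|apply: cvgZl; exact: th_cont].
- by move=> t; apply: cvgD; [exact: Sc|exact: th_cont].
- by move=> t; have := S01 t; have := th_ge0 t; have := th_le t; lra.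
- move=> t nOt; rewrite Sout// add0r; apply/eqP; apply: contrapT => /negP th0.
  apply: nOt; apply: (Hr2 t _).1.
  by rewrite /ball/= distrC; exact: th_in.
- move=> t; apply: (le_trans (ler_normD _ _)); apply: lerD => //.
  by rewrite normrZ ger0_norm// -[leRHS]mulr1 ler_wpM2l.
(* The old move is made first, then the new one from the displaced point. That point is within [dv]
   of [p t0]: [dv / 4] for [w], [dv / 4] for the old move, [dv / 2] between [p t] and [p t0]. As
   [dd_le] concerns positive steps, [th t = 0] is treated apart. *)
- exists (Num.min dl (dv / 4)); first by rewrite lt_min dl0 divr_gt0.
  move=> t w h; rewrite !lt_min => /andP[w1 w2] h0 /andP[h1 h2].
  have [th0|th0] := eqVneq (th t) 0.
    by rewrite th0 scale0r !addr0; exact: Hu.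
  rewrite scalerDr addrA scalerA; have := Hu t w h w1 h0 h1.
  have : Phi (w + h *: u t + (h * th t) *: v) <=
         Phi (w + h *: u t) + h * th t * - kappa.
    apply: Hv.
    + have ht : ball t0 r2 t by rewrite /ball/= distrC; exact: th_in.
      have /= := (Hr2 t ht).2; rewrite distrC => pt.
      have : `|h *: u t| <= h * 1.
        rewrite normrZ gtr0_norm// ler_wpM2l ?(ltW h0)//.
        by apply: (le_trans (uS t)); have := S01 t; lra.
      have -> : w + h *: u t - p t0 = (w - p t) + h *: u t + (p t - p t0).
        by rewrite addrAC [RHS]addrAC subrKA.
      have := ler_normD (w - p t + h *: u t) (p t - p t0).
      have := ler_normD (w - p t) (h *: u t); lra.
    + by rewrite mulr_gt0// lt_neqAle eq_sym th0 th_ge0.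
    + apply: (@le_lt_trans _ _ (h * 1)); last lra.
      by rewrite ler_wpM2l ?(ltW h0)//; have := th_le t; have := S01 t; lra.
  lra.
Qed.

(** Induction over the centres of a finite subcover: since an extension never lowers the strength, a
    point where it has reached 1 keeps it. *)
Lemma descent_field_compact (K : set R) : compact K -> open O -> K `<=` O ->
  (forall t, K t -> exists2 v, `|v| <= 1 & dd_le Phi (p t) v (- kappa)) ->
  exists u S, descent_field u S /\ forall t, K t -> S t = 1.
Proof.
move=> cK oO KO HK.
(* Off [K] the radius is a dummy 0. *)
have /choice[r rP] (t : R) : exists r, K t -> 0 < r /\ forall u S, descent_field u S ->
    exists u' S', [/\ descent_field u' S', (forall t, S t <= S' t) &
                      forall s, `|s - t| < r -> S' s = 1].
  have [Kt|nKt] := pselect (K t); last by exists 0.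
  have [v v1 vP] := HK t Kt.
  by have [r r0 rP] := descent_field_extend oO (KO _ Kt) v1 vP; exists r.
move: cK; rewrite compact_cover => /(_ R K (fun t => ball t (r t))) [].
- by move=> t Kt; exact: ball_open.
- by move=> t Kt; exists t => //; apply: ballxx; exact: (rP t Kt).1.
move=> D DK Kcov.
suff [u [S [uS S1]]] : exists u S, descent_field u S /\
    forall i, i \in (finmap.enum_fset D) -> forall t, `|t - i| < r i -> S t = 1.
  exists u, S; split=> // t /Kcov[i /= iD it].
  by apply: (S1 i) => //; move: it; rewrite /ball/= distrC.
have : forall i, i \in (finmap.enum_fset D) -> K i by move=> i /DK; rewrite inE.
elim: (finmap.enum_fset D) => [_|i s IH sK].
  by exists (fun=> 0), (fun=> 0); split=> //; exact: descent_field0.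
have [|u [S [uS S1]]] := IH; first by move=> j js; apply: sK; rewrite inE js orbT.
have [_ /(_ _ _ uS)[u' [S' [uS' SS' S'1]]]] := rP i (sK i (mem_head _ _)).
exists u', S'; split=> // j; rewrite inE => /predU1P[->//|js] t tj.
have := SS' t; have := strength_bound uS' t; rewrite (S1 j js t tj); lra.
Qed.

End deformation.

(** * Distance to a nonempty set *)

Section distance.
Context {R : realType} {X : normedModType R} (S : set X).
Hypothesis S_ne : S !=set0.

(** Real-valued, unlike [dist_to]: it is meant for nonempty [S], and enters real arithmetic in the
    penalty. *)
Definition dst (x : X) : R := inf [set `|x - y| | y in S].

Let dst_has_inf x : has_inf [set `|x - y| | y in S].
Proof.
by split; [have [y Sy] := S_ne; exists `|x - y|, y|exists 0 => _ [y _ <-]].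
Qed.

Lemma dst_le x y : S y -> dst x <= `|x - y|.
Proof. by move=> Sy; apply: ge_inf; [exact: (dst_has_inf x).2|exists y]. Qed.

Lemma dst_lt x r : dst x < r -> exists2 y, S y & `|x - y| < r.
Proof. by move=> /(inf_lt (dst_has_inf x).1)[_ [y Sy <-]]; exists y. Qed.

Lemma dst_ge0 x : 0 <= dst x.
Proof. by apply: lb_le_inf; [exact: (dst_has_inf x).1|move=> _ [y _ <-]]. Qed.

Lemma dst_lip x y : dst x <= dst y + `|x - y|.
Proof.
rewrite -lerBlDr; apply: lb_le_inf; first exact: (dst_has_inf y).1.
by move=> _ [z Sz <-]; have := dst_le x Sz; have := ler_distD y x z; lra.
Qed.

Lemma dst0 x : S x -> dst x = 0.
Proof.
by move=> Sx; apply/eqP; rewrite eq_le dst_ge0 andbT (le_trans (dst_le x Sx))// subrr normr0.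
Qed.

Lemma dst_gt0 x : closed S -> ~ S x -> 0 < dst x.
Proof.
move=> cS nSx; have : nbhs x (~` S) by apply: open_nbhs_nbhs; split=> //; exact: closed_openC.
move=> /nbhs_ballP[r /= r0 Hr]; apply: (lt_le_trans r0).
rewrite leNgt; apply/negP => /dst_lt[y Sy xy].
by apply: (Hr y) => //; rewrite -ball_normE.
Qed.

Lemma dst_continuous : continuous dst.
Proof.
move=> x; apply/cvgrPdist_lt => e e0; near=> y.
have : `|x - y| < e by near: y; exact: cvgr_dist_lt.
have := dst_lip x y; have := dst_lip y x; rewrite (distrC y x) => h1 h2 h3.
by rewrite ltr_norml; lra.
Unshelve. all: by end_near. Qed.

End distance.

(** * Paths, their crossings of a separating set, and almost optimal paths *)

Section curves.
Context {R : realType} {X : normedModType R}.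
Implicit Types (c p : R -> X) (a b t : R).

Lemma continuous_comp_pt (T U V : topologicalType) (f : T -> U) (g : U -> V) :
  continuous f -> continuous g -> continuous (g \o f).
Proof. by move=> cf cg x; apply: continuous_comp; [exact: cf|exact: cg]. Qed.

(** Precomposition with it extends a path on [[a, b]] by constants, turning continuity within the
    segment into continuity on the whole line. *)
Definition clamp a b t := Num.max a (Num.min b t).

Lemma clamp_continuous a b : continuous (clamp a b).
Proof.
have -> : clamp a b = (fun=> a) \max ((fun=> b) \min id) by [].
move=> t; apply: continuous_max; first exact: cvg_cst.
by apply: continuous_min; [exact: cvg_cst|exact: cvg_id].
Qed.

Lemma clamp_id a b t : a <= t <= b -> clamp a b t = t.
Proof. by move=> /andP[at_ tb]; rewrite /clamp min_r// max_r. Qed.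

Lemma clamp_in a b t : a <= b -> a <= clamp a b t <= b.
Proof. by move=> ab; rewrite /clamp le_max lexx/= ge_max ab ge_min lexx. Qed.

Lemma clamp_left a b t : a <= b -> t <= a -> clamp a b t = a.
Proof. by move=> ab ta; rewrite /clamp min_r ?max_l//; lra. Qed.

Lemma clamp_right a b t : a <= b -> b <= t -> clamp a b t = b.
Proof. by move=> ab ta; rewrite /clamp min_l ?max_r//; lra. Qed.

Lemma within_continuous_clamp a b c : a <= b -> {within `[a, b], continuous c} ->
  continuous (c \o clamp a b).
Proof.
move=> ab /subspace_continuousP cc t.
have abt : `[a, b]%classic (clamp a b t) by rewrite /= in_itv/= clamp_in.
move=> U /(cc _ abt) cU.
have ct : {for t, continuous (clamp a b)} by exact: clamp_continuous.
have := ct _ cU; apply: (@filterS _ (nbhs t)) => s /=.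
by apply; rewrite in_itv/= clamp_in.
Qed.

Lemma continuous_bounded_segment (V : normedModType R) (p : R -> V) a b :
  continuous p -> exists B, forall t, a <= t <= b -> `|p t| <= B.
Proof.
move=> cp; have : bounded_set (p @` `[a, b]).
  apply: compact_bounded; apply: continuous_compact; last exact: segment_compact.
  exact: continuous_subspaceT.
move=> [M [_ /(_ (M + 1))]]; rewrite ltrDl ltr01 => /(_ isT) H.
by exists (M + 1) => t tab; apply: H; exists t => //=; rewrite in_itv.
Qed.

Lemma continuous_bounded (V : normedModType R) (p : R -> V) a b : a <= b ->
  continuous p -> (forall t, t <= a -> p t = p a) ->
  (forall t, b <= t -> p t = p b) -> exists B, forall t, `|p t| <= B.
Proof.
move=> ab /(continuous_bounded_segment a b)[B HB] pa pb; exists B => t.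
have [ta|ta] := leP t a; first by rewrite pa//; apply: HB; lra.
have [bt|tb] := leP b t; first by rewrite pb//; apply: HB; lra.
by apply: HB; lra.
Qed.

(** The times in [[a, b]] spent in [P] form a closed bounded set, which contains its supremum. *)
Lemma last_time (P : set X) c a b : closed P -> continuous c -> a <= b ->
  P (c a) -> exists t0, [/\ a <= t0 <= b, P (c t0) &
    forall t, t0 < t <= b -> ~ P (c t)].
Proof.
move=> cP cc ab Pa; pose A := `[a, b] `&` c @^-1` P.
have A_ub : ubound A b by move=> t [/=]; rewrite in_itv/= => /andP[].
have Aa : A a by split=> //=; rewrite in_itv/= lexx ab.
have cA : closed A.
  apply: closedI; first exact: itv_closed.
  by apply: closed_comp => // t _; exact: cc.
have [] : A (sup A).
  by apply: cA; apply: closure_sup; [exists a|exists b].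
rewrite /= in_itv/= => supab Psup; exists (sup A); split=> // t /andP[st tb] Pt.
have : t <= sup A.
  apply: ub_le_sup; first by exists b.
  by split=> //=; rewrite in_itv/=; lra.
lra.
Qed.

(** If [c] missed [S], the times spent in [O0] would be open and, as the complement of those spent
    in [O1], closed in the connected segment, hence all of it. *)
Lemma path_crosses (S O0 O1 : set X) c a b : open O0 -> open O1 ->
  O0 `&` O1 = set0 -> ~` S = O0 `|` O1 -> continuous c -> a <= b ->
  O0 (c a) -> O1 (c b) -> exists2 t, a <= t <= b & S (c t).
Proof.
move=> oO0 oO1 O01 SO cc ab ca cb; apply: contrapT => nS.
have nSO t : a <= t <= b -> O0 (c t) \/ O1 (c t).
  move=> tab; have : (~` S) (c t) by move=> Sct; apply: nS; exists t.
  by rewrite SO.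
have disj x : O0 x -> O1 x -> False.
  by move=> x0 x1; have : (O0 `&` O1) x by []; rewrite O01.
pose B := `[a, b]%classic `&` c @^-1` O0.
have BE : B = `[a, b]%classic.
  apply: segment_connected.
  - by exists a; split=> //=; rewrite in_itv/= lexx ab.
  - by exists (c @^-1` O0) => //; apply: open_comp => // t _; exact: cc.
  - exists (c @^-1` (~` O1)).
      by apply: closed_comp; [move=> t _; exact: cc|exact: open_closedC].
    apply/seteqP; split=> t [/= tab Ot]; split=> //=.
      by move=> O1t; exact: (disj (c t)).
    by rewrite in_itv/= in tab; have [|/Ot] := nSO t tab.
have [_ /= O0b] : B b by rewrite BE /= in_itv/= lexx ab.
exact: (disj (c b)).
Qed.

(** The straight segment shows that there are paths at all, so the infimum can be approached; the
    path found is then clamped to live on the whole line. *)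
Lemma minimax_path (Phi : X -> R) (z0 z1 : X) dl : continuous Phi -> 0 < dl ->
  exists c, [/\ continuous c, c 0 = z0, c 1 = z1 &
    forall t, 0 <= t <= 1 -> Phi (c t) <= minimax Phi z0 z1 + dl].
Proof.
move=> cPhi dl0.
have ne : [set sup [set Phi (c t) | t in `[0, 1 : R]] | c in paths z0 z1] !=set0.
  pose l := fun t : R => z0 + t *: (z1 - z0).
  exists (sup [set Phi (l t) | t in `[0, 1 : R]]), l => //; split.
  - apply: continuous_subspaceT => t; apply: cvgD; first exact: cvg_cst.
    by apply: cvgZl; exact: cvg_id.
  - by rewrite /l scale0r addr0.
  - by rewrite /l scale1r addrC subrK.
have lt_dl : minimax Phi z0 z1 < minimax Phi z0 z1 + dl by rewrite ltrDl.
have [_ [c [cc c0 c1] <-] supc] := inf_lt ne lt_dl.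
have cc' := within_continuous_clamp ler01 cc.
exists (c \o clamp 0 1); split=> //=.
- by rewrite clamp_id ?lexx ?ler01.
- by rewrite clamp_id ?lexx ?ler01.
move=> t t01; rewrite clamp_id//; apply: le_trans (ltW supc).
apply: ub_le_sup; last by exists t => //=; rewrite in_itv.
have [B HB] := continuous_bounded_segment 0 1 (continuous_comp_pt cc' cPhi).
exists B => y [s /=]; rewrite in_itv/= => s01 <-.
by have := HB s s01; rewrite /= clamp_id//; apply: le_trans; exact: ler_norm.
Qed.

(* The last time on the side of [O0] at distance [>= e] from [S], followed by
   the first later time on the side of [O1] at distance [>= e]. *)
Lemma crossing_interval (S O0 O1 : set X) c e : S !=set0 -> 0 < e ->
  open O0 -> open O1 -> O0 `&` O1 = set0 -> ~` S = O0 `|` O1 ->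
  continuous c -> O0 (c 0) -> O1 (c 1) -> e <= dst S (c 0) -> e <= dst S (c 1) ->
  exists a b, [/\ 0 <= a /\ b <= 1, a < b, O0 (c a) /\ O1 (c b),
    e <= dst S (c a) /\ e <= dst S (c b) &
    forall t, a < t < b -> dst S (c t) < e].
Proof.
move=> S_ne e0 oO0 oO1 O01 SO cc c0 c1 e_c0 e_c1.
have disj x : O0 x -> O1 x -> False.
  by move=> x0 x1; have : (O0 `&` O1) x by []; rewrite O01.
have far x : e <= dst S x -> O0 x \/ O1 x.
  move=> ex; have : (~` S) x by move=> Sx; move: ex; rewrite dst0//; lra.
  by rewrite SO.
have cfar : closed [set x | e <= dst S x].
  apply: (@closed_comp _ _ (dst S) [set r | e <= r]); last exact: closed_ge.
  by move=> x _; exact: dst_continuous.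
(* Far from [S], lying in [O0] is the same as avoiding [O1]; the latter form makes the set
   closed. *)
pose P0 := [set x | e <= dst S x] `&` ~` O1.
pose P1 := [set x | e <= dst S x] `&` ~` O0.
have cP0 : closed P0 by apply: closedI => //; exact: open_closedC.
have cP1 : closed P1 by apply: closedI => //; exact: open_closedC.
have P0c0 : P0 (c 0) by split=> // O1c; exact: (disj (c 0)).
have [a [/andP[a0 a1] [ea nO1a] aP]] := last_time cP0 cc ler01 P0c0.
have O0a : O0 (c a) by have [|/nO1a] := far _ ea.
(* Time is reversed, so that the first visit to [P1] after [a] becomes a last time on [[-1, -a]]. *)
have cNc : continuous (c \o -%R) by apply: continuous_comp_pt => //; exact: opp_continuous.
have P1c1 : P1 ((c \o -%R) (- 1)).
  by rewrite /= opprK; split=> // O0c; exact: (disj (c 1)).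
have Na1 : - 1 <= - a by rewrite lerN2.
have [b [/andP[b0 b1] [eb nO0b] bP]] := last_time cP1 cNc Na1 P1c1.
have O1b : O1 (c (- b)) by have [/nO0b|] := far _ eb.
exists a, (- b); split=> //; first by split=> //; lra.
  rewrite lt_neqAle -lerN2 opprK b1 andbT; apply/eqP => abE.
  by apply: (disj (c a)) => //; rewrite abE.
move=> t /andP[at_ tb]; rewrite ltNge; apply/negP => et.
have [cO0|cO1] := far _ et.
- apply: (aP t); first lra.
  by split=> // O1t; exact: (disj (c t)).
- apply: (bP (- t)); first lra.
  by rewrite /= opprK; split=> // O0t; exact: (disj (c t)).
Qed.

End curves.

(** * The penalized minimax problem on a complete space of curves *)

Lemma uniform_cauchy_limit (R : realType) (X : completeNormedModType R)
    (I : Type) (u : nat -> I -> X) :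
  (forall e, 0 < e -> exists N, forall n m, (N <= n <= m)%N ->
     forall t, `|u n t - u m t| <= e) ->
  exists l, forall e, 0 < e -> exists N, forall n, (N <= n)%N ->
    forall t, `|u n t - l t| <= e.
Proof.
move=> uC.
have cv t : cvgn (fun n => u n t).
  apply/cauchy_cvgP; apply: cauchy_exP => e e0.
  have e2 : 0 < e / 2 by rewrite divr_gt0.
  have [N HN] := uC _ e2; exists (u N t); exists N => // n /= Nn.
  by rewrite -ball_normE/=; have := HN N n; rewrite leqnn Nn => /(_ isT t); lra.
exists (fun t => limn (fun n => u n t)) => e /uC[N HN]; exists N => n Nn t.
apply/ler_addgt0Pr => e1 e10.
have /cvgrPdist_lt/(_ _ e10)[M _ HM] := cv t.
(* The auxiliary index depends on [t] through [M], but the resulting bound does not. *)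
have := HM (maxn n M) (leq_maxr _ _); rewrite distrC.
have := HN n (maxn n M); rewrite Nn leq_maxl => /(_ isT t).
have := ler_distD (u (maxn n M) t) (u n t) (limn (fun n => u n t)); lra.
Unshelve. all: by end_near. Qed.

Section minimax_principle.
Context {R : realType} {X : completeNormedModType R} (Phi : X -> R).
Variables (S O0 O1 : set X) (gamma e a b : R) (c : R -> X).
Hypothesis Phi_cont : continuous Phi.
Hypothesis S_ne : S !=set0.
Hypothesis S_gamma : S `<=` superlevel Phi gamma.
Hypotheses (oO0 : open O0) (oO1 : open O1) (O01 : O0 `&` O1 = set0).
Hypothesis SO : ~` S = O0 `|` O1.
Hypothesis e_gt0 : 0 < e.
Hypotheses (lt_ab : a < b) (c_cont : continuous c) (ca : O0 (c a)) (cb : O1 (c b)).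
Hypotheses (e_ca : e <= dst S (c a)) (e_cb : e <= dst S (c b)).
Hypothesis c_near : forall t, a < t < b -> dst S (c t) < e.
Hypothesis Phi_c : forall t, a <= t <= b -> Phi (c t) <= gamma + e ^+ 2 / 4.

Let le_ab : a <= b. Proof. exact: ltW. Qed.
Let ee_gt0 : 0 < e ^+ 2. Proof. exact: exprn_gt0. Qed.

(** Lipschitz with constant [e], equal to [e ^+ 2] on [S] and to 0 at distance at least [e]: every
    crossing of [S] is raised while the ends [c a] and [c b] are not. *)
Definition psi x := Num.max 0 (e ^+ 2 - e * dst S x).

Definition penalized x := Phi x + psi x.

Let psi_far x : e <= dst S x -> psi x = 0.
Proof.
by move=> ex; rewrite /psi max_l//; have := ler_wpM2l (ltW e_gt0) ex; rewrite -expr2; lra.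
Qed.

Let psi_le x : psi x <= e ^+ 2.
Proof.
rewrite /psi ge_max ltW//= gerBl; apply: mulr_ge0; [exact: ltW|exact: dst_ge0].
Qed.

Let psi_ge0 x : 0 <= psi x.
Proof. by rewrite /psi le_max lexx. Qed.

Let psi_S x : S x -> psi x = e ^+ 2.
Proof. by move=> Sx; rewrite /psi dst0// mulr0 subr0 max_r// ltW. Qed.

Let psi_lip x y : psi x <= psi y + e * `|x - y|.
Proof.
have exy : 0 <= e * `|x - y| by rewrite mulr_ge0// ltW.
have := ler_wpM2l (ltW e_gt0) (dst_lip S_ne y x); rewrite (distrC y x) => h.
rewrite {1}/psi ge_max; apply/andP; split; first by have := psi_ge0 y; lra.
have : e ^+ 2 - e * dst S y <= psi y by rewrite /psi le_max lexx orbT.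
lra.
Qed.

Let penalized_cont : continuous penalized.
Proof.
move=> x; apply: cvgD; first exact: Phi_cont.
have -> : psi = (fun=> 0) \max (fun x => e ^+ 2 - e * dst S x) by [].
apply: continuous_max; first exact: cvg_cst.
apply: cvgB; first exact: cvg_cst.
by apply: cvgMr; exact: dst_continuous.
Qed.

(* Curves are constant outside [a, b], so that [curve_dist] and [curve_max] are
   suprema over all of R. *)
Definition curve_class : set (R -> X) := [set p | [/\ continuous p,
  (forall t, t <= a -> p t = c a) & (forall t, b <= t -> p t = c b)]].

Let Tp := {p : R -> X | curve_class p}.

Definition curve_dist (p q : R -> X) : R := sup (range (fun t => `|p t - q t|)).

Definition curve_max (p : R -> X) : R := sup (range (penalized \o p)).

Let curve_bounded (V : normedModType R) (g : X -> V) p : continuous g ->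
  curve_class p -> exists B, forall t, `|g (p t)| <= B.
Proof.
move=> cg [cp pa pb]; apply: (@continuous_bounded _ _ (g \o p) a b le_ab).
- exact: continuous_comp_pt.
- by move=> t ta; rewrite /= !pa.
- by move=> t ta; rewrite /= !pb.
Qed.

Let curve_dist_ub p q t : curve_class p -> curve_class q ->
  `|p t - q t| <= curve_dist p q.
Proof.
move=> /(curve_bounded (g := id)) [|B HB]; first by move=> x; exact: cvg_id.
move=> /(curve_bounded (g := id)) [|C HC]; first by move=> x; exact: cvg_id.
apply: ub_le_sup; last by exists t.
exists (B + C) => _ [s _ <-]; have := HB s; have := HC s => /=.
have := ler_normB (p s) (q s); lra.
Qed.

Let curve_dist_le p q r : (forall t, `|p t - q t| <= r) -> curve_dist p q <= r.
Proof.
move=> H; apply: ge_sup; first by exists `|p 0 - q 0|, 0.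
by move=> _ [t _ <-]; exact: H.
Qed.

Let curve_max_ub p t : curve_class p -> penalized (p t) <= curve_max p.
Proof.
move=> /(curve_bounded (V := R^o) penalized_cont)[B HB].
apply: ub_le_sup; last by exists t.
by exists B => _ [s _ <-]; apply: le_trans (ler_norm _) (HB s).
Qed.

Let curve_max_le p r : (forall t, penalized (p t) <= r) -> curve_max p <= r.
Proof.
move=> H; apply: ge_sup; first by exists (penalized (p 0)), 0.
by move=> _ [t _ <-]; exact: H.
Qed.

Let curve_max_ge p : curve_class p -> gamma + e ^+ 2 <= curve_max p.
Proof.
move=> Tp_p; have [cp pa pb] := Tp_p.
have [||t _ Spt] := path_crosses oO0 oO1 O01 SO cp le_ab.
- by rewrite pa.
- by rewrite pb.
have := curve_max_ub t Tp_p; rewrite /penalized psi_S//.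
by have := S_gamma Spt; rewrite /superlevel/=; lra.
Qed.

(** Keeps the nearly maximal parameters strictly between [a] and [b], where a curve may be moved
    without leaving the class. *)
Let end_low t : ~ a < t < b -> forall p, curve_class p ->
  penalized (p t) <= gamma + e ^+ 2 / 4.
Proof.
move=> nt p [_ pa pb].
have [ta|ta] := leP t a.
  by rewrite pa// /penalized psi_far// addr0; apply: Phi_c; rewrite lexx le_ab.
have [tb|tb] := leP b t.
  by rewrite pb// /penalized psi_far// addr0; apply: Phi_c; rewrite lexx le_ab.
by case: nt; rewrite ta tb.
Qed.

Let curve_complete (u : nat -> Tp) :
  (forall r, 0 < r -> exists N, forall n m, (N <= n <= m)%N ->
     curve_dist (sval (u n)) (sval (u m)) <= r) ->
  exists p : Tp, forall r, 0 < r -> exists N, forall n, (N <= n)%N ->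
     curve_dist (sval (u n)) (sval p) <= r.
Proof.
move=> uC; have [r /uC[N HN]|l Hl] := @uniform_cauchy_limit R X R (fun n => sval (u n)).
  exists N => n m nm t; apply: le_trans (HN n m nm).
  by apply: curve_dist_ub; exact: svalP.
have l_eq t z : (forall n, sval (u n) t = z) -> l t = z.
  move=> uz; apply/eqP; rewrite eq_sym -subr_eq0 -normr_le0; apply/ler_addgt0Pr => r.
  by move=> /Hl[N /(_ N (leqnn N) t)]; rewrite uz add0r.
have Tl : curve_class l.
  split.
  - move=> t; apply/cvgrPdist_lt => r r0.
    have r3 : 0 < r / 3 by rewrite divr_gt0.
    have [N /(_ N (leqnn N)) HN] := Hl _ r3.
    have [uc _ _] := svalP (u N).
    have /cvgrPdist_lt/(_ _ r3) : {for t, continuous (sval (u N))} by exact: uc.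
    apply: filterS => s us.
    have := HN t; have := HN s; rewrite (distrC _ (l t)).
    have := ler_distD (sval (u N) t) (l t) (l s).
    have := ler_distD (sval (u N) s) (sval (u N) t) (l s); lra.
  - by move=> t ta; apply: l_eq => n; have [_ + _] := svalP (u n); exact.
  - by move=> t tb; apply: l_eq => n; have [_ _ +] := svalP (u n); exact.
exists (exist _ l Tl) => r /Hl[N HN]; exists N => n Nn /=.
by apply: curve_dist_le; exact: HN.
Qed.

(** At each fixed [t] the bound [r] passes to the limit by continuity of [penalized], and
    [curve_max] is a supremum over [t]. *)
Let curve_max_lsc (u : nat -> Tp) (p : Tp) r N :
  (forall r, 0 < r -> exists N, forall n, (N <= n)%N ->
     curve_dist (sval (u n)) (sval p) <= r) ->
  (forall n, (N <= n)%N -> curve_max (sval (u n)) <= r) ->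
  curve_max (sval p) <= r.
Proof.
move=> up ur; apply: curve_max_le => t; apply/ler_addgt0Pr => e1 e10.
have /cvgrPdist_lt/(_ _ e10)/nbhs_ballP[dl /= dl0 Hdl] :
  {for sval p t, continuous penalized} by exact: penalized_cont.
have dl2 : 0 < dl / 2 by rewrite divr_gt0.
have [M HM] := up _ dl2; pose n := maxn N M.
have pu : ball (sval p t) dl (sval (u n) t).
  rewrite -ball_normE/= distrC.
  have := HM n (leq_maxr _ _); have := curve_dist_ub t (svalP (u n)) (svalP p); lra.
have := Hdl _ pu; rewrite /= ltr_norml.
have := ur n (leq_maxl _ _); have := curve_max_ub t (svalP (u n)); lra.
Qed.

(** Ekeland with slope [e / 2] gives a curve [p] that is almost minimal for [curve_max]. Descent of
    [Phi] at rate [3 * e] leaves rate [2 * e] for [penalized], since [psi] regains at most [e]; this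
    beats [e / 2]. *)
Theorem no_uniform_descent :
  ~ (forall x, dst S x <= 2 * e -> `|Phi x - gamma| <= 2 * e ^+ 2 ->
       exists2 v, `|v| <= 1 & dd_le Phi x v (- (3 * e))).
Proof.
move=> descent.
pose c0 := c \o clamp a b.
have Tc0 : curve_class c0.
  split; first exact: (continuous_comp_pt (@clamp_continuous _ a b) c_cont).
  - by move=> t ta; rewrite /c0/= clamp_left.
  - by move=> t ta; rewrite /c0/= clamp_right.
have e2 : 0 < e / 2 by rewrite divr_gt0.
have [||||||[p Tp_p] [/= p_c0 p_min]] := @ekeland R Tp
  (fun p q => curve_dist (sval p) (sval q)) (fun p => curve_max (sval p))
  _ _ _ _ _ _ (exist _ c0 Tc0) (e / 2) e2.
- move=> p q; apply: le_trans (curve_dist_ub 0 (svalP p) (svalP q)); exact: normr_ge0.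
- move=> p; apply/eqP; rewrite eq_le; apply/andP; split.
    by apply: curve_dist_le => t; rewrite subrr normr0.
  by apply: le_trans (curve_dist_ub 0 (svalP p) (svalP p)); exact: normr_ge0.
- move=> q p r; apply: curve_dist_le => t.
  have := curve_dist_ub t (svalP p) (svalP q); have := curve_dist_ub t (svalP q) (svalP r).
  have := ler_distD (sval q t) (sval p t) (sval r t); lra.
- exact: curve_complete.
- exact: curve_max_lsc.
- by exists (gamma + e ^+ 2) => _ [p _ <-]; exact: curve_max_ge (svalP p).
have Ic0 : curve_max c0 <= gamma + e ^+ 2 / 4 + e ^+ 2.
  apply: curve_max_le => t; apply: lerD; last exact: psi_le.
  by apply: Phi_c; exact: clamp_in.
have Ip := curve_max_ge Tp_p.
(* From [c0] to [p] the maximum drops by at most [e ^+ 2 / 4], and this drop dominates [e / 2] times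
   the distance. So [p] stays within [3 * e / 2] of [S] on the open interval. *)
have dist_c0p : curve_dist c0 p <= e / 2.
  rewrite -(ler_pM2l e2); have : e / 2 * (e / 2) = e ^+ 2 / 4 by field.
  lra.
have d_ge0 : 0 <= e / 2 * curve_dist c0 p.
  rewrite mulr_ge0 ?(ltW e2)//.
  by apply: le_trans (curve_dist_ub 0 Tc0 Tp_p); exact: normr_ge0.
have [cp pa pb] := Tp_p.
(* Small enough that [K] excludes the ends: these are at most [gamma + e ^+ 2 / 4], while the
   maximum is at least [gamma + e ^+ 2]. *)
pose eta := e ^+ 2 / 4.
pose K := [set t | curve_max p - eta <= penalized (p t)].
pose O := [set t | a < t < b].
have oO : open O by have := @itv_open _ R a b; rewrite set_itvoo.
have KO : K `<=` O.
  move=> t Kt; apply: contrapT => /end_low/(_ _ Tp_p).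
  by move: Kt; rewrite /K/= /eta; have := ee_gt0; lra.
have cK : compact K.
  apply: (@subclosed_compact _ K `[a, b]%classic); last 2 first.
  - exact: segment_compact.
  - by move=> t /KO /andP[ta tb]; rewrite /= in_itv/= !ltW.
  apply: (@closed_comp _ _ (penalized \o p) [set r | curve_max p - eta <= r]).
    by move=> t _; exact: (continuous_comp_pt cp penalized_cont).
  exact: closed_ge.
have [|u [St [uS S1]]] := @descent_field_compact R X Phi p (3 * e) O cp K cK oO KO.
- move=> t Kt; have abt := KO _ Kt; apply: descent.
  + have := curve_dist_ub t Tc0 Tp_p; rewrite distrC.
    have := dst_lip S_ne (p t) (c0 t).
    have : dst S (c0 t) < e.
      by rewrite /c0/= clamp_id; [exact: c_near|case/andP: abt => *; rewrite !ltW].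
    lra.
  + have := curve_max_ub t Tp_p; have := psi_le (p t); have := psi_ge0 (p t).
    move: Kt; rewrite /K/= /eta /penalized => h1 h2 h3 h4.
    by rewrite ler_norml; apply/andP; split; lra.
have [dl dl0 rate] := descent_rate uS.
(* The bound [e / 8] gives [2 * e * h <= eta]: parameters outside [K], already [eta] below the
   maximum, respect the new bound even if they do not descend. *)
pose h := Num.min (dl / 2) (e / 8).
have h0 : 0 < h by rewrite lt_min !divr_gt0.
have hdl : h < dl by rewrite /h gt_min; apply/orP; left; lra.
have heta : 2 * e * h <= eta.
  have : h <= e / 8 by rewrite /h ge_min lexx orbT.
  move=> /(ler_wpM2l (ltW e_gt0)); rewrite mulrA -expr2 /eta; lra.
pose q t := p t + h *: u t.
have u0 t : ~ O t -> u t = 0.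
  move=> nO; apply/eqP; rewrite -normr_le0.
  by have := descent_norm uS t; rewrite (strength_out uS nO).
have Tq : curve_class q.
  split.
  - move=> t; apply: cvgD; first exact: cp.
    by apply: cvgZr; exact: (descent_cont uS).
  - by move=> t ta; rewrite /q u0 ?scaler0 ?addr0 ?pa// /O/=; lra.
  - by move=> t ta; rewrite /q u0 ?scaler0 ?addr0 ?pb// /O/=; lra.
have hu t : `|h *: u t| <= h * St t.
  by rewrite normrZ gtr0_norm// ler_wpM2l ?(ltW h0)//; exact: (descent_norm uS).
have dist_pq : curve_dist p q <= h.
  apply: curve_dist_le => t; rewrite /q opprD addrA subrr add0r normrN.
  apply: (le_trans (hu t)); rewrite -[leRHS]mulr1 ler_wpM2l ?(ltW h0)//.
  by have /andP[] := strength_bound uS t.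
(* [Phi] falls by at least [3 * e * h * St t], and [psi] rises by at most [e * h * St t]. *)
have penalized_q t : penalized (q t) <= penalized (p t) - 2 * e * h * St t.
  have pt : `|p t - p t| < dl by rewrite subrr normr0.
  have := rate t (p t) h pt h0 hdl.
  have := psi_lip (q t) (p t); rewrite {2}/q addrAC subrr add0r.
  have := ler_wpM2l (ltW e_gt0) (hu t).
  rewrite /penalized -/(q t); lra.
have max_q : curve_max q <= curve_max p - 2 * e * h.
  apply: curve_max_le => t; apply: (le_trans (penalized_q t)).
  have [Kt|/negP] := pselect (K t).
    by rewrite S1// mulr1; have := curve_max_ub t Tp_p; lra.
  rewrite /K/= -ltNge => Kt.
  have : 0 <= 2 * e * h * St t.
    rewrite !mulr_ge0 ?(ltW h0) ?(ltW e_gt0)//.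
    by have /andP[] := strength_bound uS t.
  lra.
have := p_min (exist _ q Tq) => /=.
have := ler_wpM2l (ltW e2) dist_pq.
have := mulr_gt0 e_gt0 h0; lra.
Qed.

End minimax_principle.

(** * From the Palais-Smale condition to uniform descent, and conclusion *)

Lemma locally_lipschitz_continuous (R : realType) (X : normedModType R)
  (Phi : X -> R) : locally_lipschitz Phi -> continuous Phi.
Proof.
move=> lipP x; have [U Ux [M [_ HM]]] := lipP x.
pose k := `|M| + 1; have k0 : 0 < k by rewrite ltr_wpDl.
have kM : M < k by rewrite (le_lt_trans (ler_norm M))// ltrDl.
apply/cvgrPdist_lt => e e0.
near=> y; have Uy : U y by near: y.
have := HM k kM (x, y); rewrite /= => /(_ (conj (nbhs_singleton Ux) Uy)) H.
apply: (le_lt_trans H); rewrite -ltr_pdivlMl//.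
near: y; apply: cvgr_dist_lt => //; by rewrite mulr_gt0 ?invr_gt0.
Unshelve. all: by end_near. Qed.

(** Failure of descent at every rate 1/(n+1) yields points with subgradients of norm about 1/(n+1)
    or less. As [F] is bounded, the weight [1 + |x_n|] is harmless, so [CPS] provides a limit point,
    which is critical. *)
Lemma CPS_uniform_descent (R : realType) (X : normedModType R) (Phi : X -> R)
    (F : set X) (gamma : R) : continuous Phi -> closed F -> bounded_set F ->
  CPS Phi F gamma ->
  ~ (exists x, [/\ F x, Phi x = gamma & clarke_subdiff Phi x \0]) ->
  exists2 dl, 0 < dl & forall x y, F y -> `|x - y| < dl ->
    `|Phi x - gamma| < dl -> exists2 v, `|v| <= 1 & dd_le Phi x v (- dl).
Proof.
move=> cPhi cF bF cps ncrit; apply: contrapT => ndesc.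
have /choice[w wP] (n : nat) : exists w : X * X, [/\ F w.2, `|w.1 - w.2| < n.+1%:R^-1,
    `|Phi w.1 - gamma| < n.+1%:R^-1 &
    forall v, `|v| <= 1 -> ~ dd_le Phi w.1 v (- n.+1%:R^-1)].
  apply: contrapT => nw; apply: ndesc.
  exists n.+1%:R^-1; first by rewrite invr_gt0.
  move=> x y Fy xy Px; apply: contrapT => nv; apply: nw.
  by exists (x, y); split=> // v v1 vd; apply: nv; exists v.
pose x_ n := (w n).1.
have inv0 n : 0 < n.+1%:R^-1 :> R by rewrite invr_gt0.
have [M [_ /(_ (M + 1))]] := bF; rewrite ltrDl ltr01 => /(_ isT) FM.
(* [M + 1] bounds [F], and [x_ n] is within 1 of [F]. *)
have x_bound n : `|x_ n| <= M + 2.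
  have [Fy xy _ _] := wP n; have /= := FM _ Fy.
  have : n.+1%:R^-1 <= 1 :> R by rewrite invf_le1// ler1n.
  have := ler_normD ((w n).1 - (w n).2) (w n).2; rewrite subrK.
  rewrite /x_; move: (n.+1%:R^-1) xy => r; lra.
(* By homogeneity [v] may be scaled to norm 1, except for [v = 0], where [dd_le] directly forces [k]
   to be nonnegative. *)
have slope n v k : dd_le Phi (x_ n) v k -> - (n.+1%:R^-1 * `|v|) <= k.
  move=> vk; rewrite leNgt; apply/negP => kv.
  have [_ _ _ nd] := wP n.
  have [v0|v0] := eqVneq v 0.
    have [dl dl0 H] := vk; have dl2 : 0 < dl / 2 by lra.
    have xx : `|x_ n - x_ n| < dl by rewrite subrr normr0.
    have := H (x_ n) (dl / 2) xx dl2 ltac:(lra).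
    rewrite v0 scaler0 addr0 lerDl pmulr_rge0//.
    by move: kv; rewrite v0 normr0 mulr0 oppr0; lra.
  have nv0 : 0 < `|v|^-1 by rewrite invr_gt0 normr_gt0.
  apply: (nd (`|v|^-1 *: v)).
    by rewrite normrZ gtr0_norm// mulVf// normr_eq0.
  have [dl dl0 H] := dd_leZ nv0 vk; exists dl => // y h yx h0 hdl.
  apply: (le_trans (H y h yx h0 hdl)); rewrite lerD2l ler_wpM2l ?(ltW h0)//.
  by rewrite ler_pdivrMl ?normr_gt0// mulrN mulrC ltW.
have min_norm n : 0 <= min_subdiff_norm Phi (x_ n) <= n.+1%:R^-1.
  by apply: min_subdiff_norm_bounds; [rewrite ltW|exact: slope].
have [|||k k_inc cvk] := cps x_.
- apply/fine_cvgP; split.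
    near=> n; have [Fy _ _ _] := wP n; rewrite ge0_fin_numE.
      by apply: le_lt_trans (ltry `|x_ n - (w n).2|); apply: ereal_inf_lbound; exists (w n).2.
    by apply: le_ereal_inf_tmp => _ [y _ <-]; rewrite lee_fin.
  apply/cvgrPdist_lt => e e0; have [N HN] := natSinv_lt e0; near=> n.
  have [Fy xy _ _] := wP n.
  have : (n.+1%:R^-1 : R) < e by apply: HN; near: n; exact: nbhs_infty_ge.
  have d0 : (0 <= dist_to (x_ n) F)%E.
    by apply: le_ereal_inf_tmp => _ [y _ <-]; rewrite lee_fin.
  have d1 : (dist_to (x_ n) F <= `|x_ n - (w n).2|%:E)%E.
    by apply: ereal_inf_lbound; exists (w n).2.
  have dfin : dist_to (x_ n) F \is a fin_num.
    by rewrite ge0_fin_numE//; apply: le_lt_trans d1 (ltry _).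
  rewrite sub0r normrN ger0_norm ?fine_ge0//=.
  move: d1; rewrite -(fineK dfin) lee_fin /=; move: xy; rewrite /x_.
  by move: (n.+1%:R^-1) => r; lra.
- apply/cvgrPdist_lt => e e0; have [N HN] := natSinv_lt e0; near=> n.
  have [_ _ Px _] := wP n; rewrite distrC; apply: (lt_trans Px).
  by apply: HN; near: n; exact: nbhs_infty_ge.
- apply/cvgrPdist_lt => e e0.
  have M0 : 0 < M + 3 by have := le_trans (normr_ge0 _) (x_bound 0%N); lra.
  have eM : 0 < e / (M + 3) by rewrite divr_gt0.
  have [N HN] := natSinv_lt eM; near=> n.
  have /andP[m0 m1] := min_norm n.
  have xn0 : 0 <= 1 + `|x_ n| by rewrite addr_ge0.
  rewrite sub0r normrN ger0_norm; last exact: mulr_ge0.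
  apply: (@le_lt_trans _ _ ((M + 3) * n.+1%:R^-1)).
    by apply: ler_pM => //; have := x_bound n; lra.
  rewrite mulrC -ltr_pdivlMr//.
  by apply: HN; near: n; exact: nbhs_infty_ge.
have kn n : (n <= k n)%N.
  elim: n => // n IH; apply: (leq_ltn_trans IH).
  by rewrite ltnNge; have := k_inc n.+1 n; rewrite !leEnat => ->; rewrite ltnn.
pose xb := limn (x_ \o k).
(* One index making both the tolerance 1/(n+1) and the distance to the limit small serves all three
   conclusions about [xb]. *)
have close e : 0 < e -> exists n, [/\ n.+1%:R^-1 < e & `|xb - x_ n| < e].
  move=> e0; have [N HN] := natSinv_lt e0.
  have /cvgrPdist_lt/(_ _ e0)[N' _ HN'] := cvk.
  exists (k (maxn N N')); split.
    by apply: HN; apply: leq_trans (kn _); exact: leq_maxl.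
  by apply: HN'; exact: leq_maxr.
apply: ncrit; exists xb; split.
- rewrite (closure_id F).1// => B /nbhs_ballP[r /= r0 HB].
  have r2 : 0 < r / 2 by rewrite divr_gt0.
  have [n [nr xr]] := close _ r2; have [Fy xy _ _] := wP n.
  exists (w n).2; split=> //; apply: HB; rewrite -ball_normE/=.
  have := ler_distD (x_ n) xb (w n).2.
  by move: xy nr; rewrite -/(x_ n); move: (n.+1%:R^-1) => s; lra.
- apply/eqP; rewrite -subr_eq0 -normr_le0; apply/ler_addgt0Pr => e e0; rewrite add0r.
  have e2 : 0 < e / 2 by rewrite divr_gt0.
  have /cvgrPdist_lt/(_ _ e2)/nbhs_ballP[r /= r0 Hr] :
    {for xb, continuous Phi} by exact: cPhi.
  have er : 0 < Num.min r (e / 2) by rewrite lt_min r0.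
  have [n []] := close _ er; rewrite !lt_min => /andP[_ ne] /andP[xr _].
  have := Hr (x_ n); rewrite -ball_normE/= => /(_ xr).
  have [_ _ Px _] := wP n; have := ler_distD (Phi (x_ n)) (Phi xb) gamma.
  by move: Px ne; rewrite -/(x_ n); move: (n.+1%:R^-1) => s; lra.
(* The bound [dd_le] at [xb] is inherited with half the radius by nearby [x_ n]. There [slope] gives
   [s] at least [-|v|/(n+1)], hence above [- e]. *)
- apply: clarke_subdiffI; first by move=> x; exact: cvg_cst.
  move=> v s [dl dl0 H]; change (0 <= s); apply/ler_addgt0Pr => e e0.
  have v1 : 0 < `|v| + 1 by rewrite ltr_wpDl.
  have er : 0 < Num.min (dl / 2) (e / (`|v| + 1)) by rewrite lt_min !divr_gt0.
  have [n []] := close _ er; rewrite !lt_min => /andP[_ ne] /andP[xr _].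
  have : dd_le Phi (x_ n) v s.
    exists (dl / 2); first by rewrite divr_gt0.
    move=> y h yx h0 hdl; apply: H => //; last lra.
    have := ler_distD (x_ n) y xb; rewrite (distrC (x_ n) xb); lra.
  move=> /slope; move: ne; rewrite ltr_pdivlMr//.
  have := inv0 n; have := normr_ge0 v; move: (n.+1%:R^-1) => r; lra.
Unshelve. all: by end_near. Qed.

Theorem theorem1p12 (R : realType) (X : completeNormedModType R)
    (Phi : X -> R) (z0 z1 : X) (F : set X)
    (Phi_lip : locally_lipschitz Phi)
    (F_closed : closed F) (F_bounded : bounded_set F)
    (F_sep : separates (F `&` superlevel Phi (minimax Phi z0 z1)) z0 z1)
    (Phi_CPS : CPS Phi F (minimax Phi z0 z1)) :
  exists xbar : X,
    [/\ F xbar,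
        Phi xbar = minimax Phi z0 z1
      & clarke_subdiff Phi xbar \0].
Proof.
have cPhi := locally_lipschitz_continuous Phi_lip.
apply: contrapT => /(CPS_uniform_descent cPhi F_closed F_bounded Phi_CPS)[dl dl0 descent].
move: F_sep => []; set gamma := minimax Phi z0 z1 in descent *.
set S := F `&` _ => cS [A0 [A1 [oO0 oO1 O01 SO [A0z A1z]]]].
have nS z : A0 z \/ A1 z -> ~ S z by move=> Oz; have : (A0 `|` A1) z by []; rewrite -SO.
(* Any path from [z0] to [z1] will do here: its crossing point shows that [S] is nonempty. *)
have [c1 [c1c c10 c11 _]] := minimax_path z0 z1 cPhi ltr01.
have S_ne : S !=set0.
  have [||t _ St] := path_crosses oO0 oO1 O01 SO c1c (@ler01 R).
  - by rewrite c10.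
  - by rewrite c11.
  by exists (c1 t).
have dz0 : 0 < dst S z0 by apply: dst_gt0 => //; apply: nS; left.
have dz1 : 0 < dst S z1 by apply: dst_gt0 => //; apply: nS; right.
(* The distances let [crossing_interval] start from [z0] and [z1]. The bound 1 gives [e ^+ 2 <= e];
   with [dl / 4], both [2 * e] and [2 * e ^+ 2] are below [dl], and the rate [dl] exceeds
   [3 * e]. *)
pose e := Num.min (Num.min (dst S z0) (dst S z1)) (Num.min 1 (dl / 4)).
have e0 : 0 < e by rewrite !lt_min dz0 dz1 ltr01 divr_gt0.
have /andP[/andP[ez0 ez1] /andP[e1 edl]] : (e <= dst S z0) && (e <= dst S z1) &&
    ((e <= 1) && (e <= dl / 4)) by rewrite -!le_min.
have ee0 : 0 < e ^+ 2 / 4 by rewrite divr_gt0 ?exprn_gt0.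
have [c [cc cz0 cz1 c_low]] := minimax_path z0 z1 cPhi ee0.
have [||||a [b [[a0 b1] lt_ab [ca cb] [ea eb] c_near]]] :=
    crossing_interval S_ne e0 oO0 oO1 O01 SO cc.
- by rewrite cz0.
- by rewrite cz1.
- by rewrite cz0.
- by rewrite cz1.
have c_ab t : a <= t <= b -> Phi (c t) <= gamma + e ^+ 2 / 4.
  by move=> tab; apply: c_low; lra.
have SsubG : S `<=` superlevel Phi gamma by move=> x [].
apply: (no_uniform_descent cPhi S_ne SsubG oO0 oO1 O01 SO e0 lt_ab cc ca cb ea eb
  c_near c_ab) => x xS xg.
have e2e : e ^+ 2 <= e by rewrite expr2 -[leRHS]mulr1 ler_wpM2l// ltW.
have xdl : dst S x < dl by lra.
have [y [Fy _] xy] := dst_lt S_ne xdl.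
have xgdl : `|Phi x - gamma| < dl by lra.
have [v v1 [r r0 Hr]] := descent x y Fy xy xgdl.
exists v => //; exists r => // w h wx h0 hr; apply: (le_trans (Hr w h wx h0 hr)).
by rewrite lerD2l ler_wpM2l ?(ltW h0)//; lra.
Qed.
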